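(* Let $V$ be a finite set with $|V|=n\ge 5$. Then there is an anchor $\mathcal{E}$ in $V$ that consists of exactly $3\binom{n-2}{2}+1$ three-point subsets of $V$.
   Context: Given a metric space $(V,\mathrm{dist})$, write $[rst]$ to signify that $r,s,t$ are pairwise distinct points of $V$ and $\mathrm{dist}(r,s)+\mathrm{dist}(s,t)=\mathrm{dist}(r,t)$. Three-point subsets of $V$ are called triangles; a triangle is called degenerate if its three points can be named $r,s,t$ so that $[rst]$. A set $\mathcal{E}$ of three-point subsets of a set $V$ is called an anchor in $V$ if, for every metric $\mathrm{dist}$ on $V$ such that all triangles in $\mathcal{E}$ are degenerate in $(V,\mathrm{dist})$, there is a linear (total) order $\preceq$ on $V$ such that, for all $r,s,t\in V$, $r\prec s\prec t$ implies $[rst]$. *)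

(* Defs.v *)
From mathcomp Require Import all_boot all_order all_algebra.
From mathcomp Require Import wochoice reals.

Set Implicit Arguments.
Unset Strict Implicit.
Unset Printing Implicit Defensive.

Import Order.TTheory GRing.Theory Num.Theory.

Local Open Scope ring_scope.

(* The fields of the isMetric factory of MathComp-Analysis, as a predicate: the
   anchor property quantifies over all metrics on one fixed carrier, whereas a
   metricType bundles its own carrier and distance.  Nonnegativity follows. *)
Record is_metric (R : realType) (V : Type) (dist : V -> V -> R) : Prop :=
  IsMetric {
    dist_refl : forall x, dist x x = 0;
    dist_eq0 : forall x y, dist x y = 0 -> x = y;
    dist_sym : forall x y, dist x y = dist y x;
    dist_triangle : forall y x z, dist x z <= dist x y + dist y z
  }.

Definition between (R : realType) (V : eqType) (dist : V -> V -> R)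
    (r s t : V) : Prop :=
  [/\ r != s, s != t, r != t & dist r s + dist s t = dist r t].

Definition degenerate (R : realType) (V : finType) (dist : V -> V -> R)
    (T : {set V}) : Prop :=
  exists r s t : V, T = [set r; s; t] /\ between dist r s t.

Definition anchor (R : realType) (V : finType) (E : {set {set V}}) : Prop :=
  (forall T : {set V}, T \in E -> #|T| = 3%N) /\
  forall dist : V -> V -> R,
    is_metric dist ->
    (forall T : {set V}, T \in E -> degenerate dist T) ->
    exists le : rel V,
      total_order le /\
      forall r s t : V,
        le r s && (r != s) -> le s t && (s != t) -> between dist r s t.

(* Main.v *)
(** The anchor consists of all 3-sets that meet a fixed 3-set [{a, b, c}].

    Place [a], [b], [c] on the real line at [A], [B], [C].  Degeneracy of a
    triangle [{z, x, y}] whose sides at [z] are [|X - Z|] and [|Y - Z|] says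
    that its third side is [|X - Y|] or [|X + Y - 2 Z|].  Applied to a further
    point [x] this shows that either [x] can be placed on the line
    consistently with [a], [b], [c], or [x] forms with them the exceptional
    quadruple in which opposite distances agree.  A fifth point rules out the
    exception.  Finally, two placed points [x], [y] at a distance other than
    [|X - Y|] would satisfy [dist x y = |X + Y - 2 Z|] for the three distinct
    values [Z = A, B, C], which is impossible. *)
Require Import Defs.
From mathcomp Require Import all_boot all_order all_algebra.
From mathcomp Require Import wochoice reals.
From mathcomp Require Import zify ring lra.

Set Implicit Arguments.
Unset Strict Implicit.
Unset Printing Implicit Defensive.

Import Order.TTheory GRing.Theory Num.Theory.

Local Open Scope ring_scope.

(** * Degenerate triangles in real coordinates *)

Lemma metric_ge0 (R : realType) (V : Type) (d : V -> V -> R) (x y : V) :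
  is_metric d -> 0 <= d x y.
Proof.
move=> dM; have := dist_triangle dM y x x.
by rewrite (dist_refl dM) (dist_sym dM y x); lra.
Qed.

Lemma metric_gt0 (R : realType) (V : eqType) (d : V -> V -> R) (x y : V) :
  is_metric d -> x != y -> 0 < d x y.
Proof.
move=> dM xy; rewrite lt0r metric_ge0 // andbT.
by apply: contra_neq xy; apply: dist_eq0.
Qed.

Lemma degenerateP (R : realType) (V : finType) (d : V -> V -> R) (x y z : V) :
  is_metric d -> degenerate d [set x; y; z] ->
  [\/ d x y + d y z = d x z, d x y + d x z = d y z | d x z + d y z = d x y].
Proof.
move=> dM [r [s [t [E [rs st rt dE]]]]].
have: r \in [set x; y; z] by rewrite E !inE eqxx.
have: s \in [set x; y; z] by rewrite E !inE eqxx orbT.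
have: t \in [set x; y; z] by rewrite E !inE eqxx !orbT.
have sym := dist_sym dM.
rewrite !inE -!orbA => /or3P[] /eqP Et /or3P[] /eqP Es /or3P[] /eqP Er; subst;
  rewrite ?eqxx // in rs st rt *;
  move: dE; rewrite ?(sym y x) ?(sym z x) ?(sym z y) => dE;
  by [apply: Or31; lra | apply: Or32; lra | apply: Or33; lra].
Qed.

Lemma eq_norm_cases (R : realDomainType) (x y : R) :
  `|x| = `|y| -> x = y \/ x = - y.
Proof. by move/eqP; rewrite eqr_norm2 => /orP[] /eqP; [left | right]. Qed.

(** In a degenerate triangle the third side is the sum or the absolute difference of the sides at
    [z]. Up to sign, [|X - Z|] and [|Y - Z|] combine to [(X - Z) - (Y - Z)] or
    [(X - Z) + (Y - Z)]. *)
Lemma third_side (R : realType) (V : finType) (d : V -> V -> R) (z x y : V)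
    (X Y Z : R) :
  is_metric d -> degenerate d [set z; x; y] ->
  d z x = `|X - Z| -> d z y = `|Y - Z| ->
  d x y = `|X - Y| \/ d x y = `|X + Y - 2 * Z|.
Proof.
move=> dM /(degenerateP dM) D zx zy; have := metric_ge0 x y dM.
move: D; rewrite {}zx {}zy.
case: (ger0P (X - Z)); case: (ger0P (Y - Z)); case: (ger0P (X - Y));
  case: (ger0P (X + Y - 2 * Z)) => ? ? ? ? [] ? ?;
  by [left; lra | right; lra].
Qed.

Lemma place_third (R : realType) (V : finType) (d : V -> V -> R) (a b x : V)
    (A B : R) :
  is_metric d -> degenerate d [set a; b; x] -> d a b = `|A - B| ->
  exists X, d a x = `|X - A| /\ d b x = `|X - B|.
Proof.
move=> dM /(degenerateP dM) D ab; move: D; rewrite {}ab.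
have := metric_ge0 a x dM; have := metric_ge0 b x dM.
move: (d a x) (d b x) => p q q0 p0 D.
suff [X [-> ->]] : exists X, p = `|X - A| /\ q = `|X - B| by exists X.
have [AB|BA] := leP A B.
  (* The point [x] goes to the side of [a] away from [b] exactly in the second case, where [a] lies
     between [b] and [x]. *)
  move: D; rewrite (ler0_norm (_ : A - B <= 0)) ?subr_le0 // => -[] D;
    [exists (A + p) | exists (A - p) | exists (A + p)]; split;
    by [rewrite ger0_norm; lra | rewrite ler0_norm; lra].
move: D; rewrite (gtr0_norm (_ : 0 < A - B)) ?subr_gt0 // => -[] D;
  [exists (A - p) | exists (A + p) | exists (A - p)]; split;
  by [rewrite ger0_norm; lra | rewrite ler0_norm; lra].
Qed.

(** At most two reals lie at a given distance from [M]. *)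
Lemma no_three_equidistant (R : realDomainType) (M A B C : R) :
  A <> B -> B <> C -> A <> C ->
  `|M - 2 * A| = `|M - 2 * B| -> `|M - 2 * B| = `|M - 2 * C| -> False.
Proof.
move=> AB BC AC /eq_norm_cases[] ? /eq_norm_cases[] ?.
- by apply: AB; lra.
- by apply: AB; lra.
- by apply: BC; lra.
- by apply: AC; lra.
Qed.

(** * Coordinates relative to three points on the line *)

Section Placement.
Variables (R : realType) (V : finType) (d : V -> V -> R) (a b c : V).
Variables (A B C : R).
Hypotheses (dM : is_metric d) (ab : a != b) (bc : b != c) (ac : a != c).
Hypotheses (dab : d a b = `|A - B|) (dbc : d b c = `|B - C|).
Hypothesis dac : d a c = `|A - C|.
Hypothesis deg : forall z x y, z \in [:: a; b; c] ->
  z != x -> z != y -> x != y -> degenerate d [set z; x; y].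

Definition placed (x : V) (X : R) : Prop :=
  [/\ d a x = `|X - A|, d b x = `|X - B| & d c x = `|X - C|].

Definition exceptional (x : V) : Prop :=
  [/\ d a x = `|B - C|, d b x = `|A - C| & d c x = `|A - B|].

Let AB : A <> B.
Proof. by move=> E; have := metric_gt0 dM ab; rewrite dab E subrr normr0 ltxx. Qed.

Let BC : B <> C.
Proof. by move=> E; have := metric_gt0 dM bc; rewrite dbc E subrr normr0 ltxx. Qed.

Let AC : A <> C.
Proof. by move=> E; have := metric_gt0 dM ac; rewrite dac E subrr normr0 ltxx. Qed.

Let ina : a \in [:: a; b; c]. Proof. by rewrite !inE eqxx. Qed.
Let inb : b \in [:: a; b; c]. Proof. by rewrite !inE eqxx orbT. Qed.
Let inc : c \in [:: a; b; c]. Proof. by rewrite !inE eqxx !orbT. Qed.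

Lemma placed_or_exceptional (x : V) :
  a != x -> b != x -> c != x -> (exists X, placed x X) \/ exceptional x.
Proof.
move=> ax bx cx.
have [X [daX dbX]] := place_third dM (deg ina ab ax bx) dab.
have dac' : d a c = `|C - A| by rewrite distrC.
have dbc' : d b c = `|C - B| by rewrite distrC.
have [E|Ea] := third_side dM (deg ina ac ax cx) dac' daX.
  by left; exists X; split=> //; rewrite distrC.
have [E|Eb] := third_side dM (deg inb bc bx cx) dbc' dbX.
  by left; exists X; split=> //; rewrite distrC.
(* Both triangles rejected [|C - X|], so the two reflected values agree; since [A] and [B] differ,
   [C + X = A + B]. *)
right; have: `|C + X - 2 * A| = `|C + X - 2 * B| by rewrite -Ea.
case/eq_norm_cases=> E; first by case: AB; lra.
have EX : X = A + B - C by lra.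
split; [rewrite daX | rewrite dbX | rewrite Ea distrC]; rewrite EX;
  by congr `|_|; ring.
Qed.

(** Each of [a], [b], [c] is equidistant from [x] and [y], hence is the middle point of its triangle
    and lies at distance [d x y / 2] from [x]. Then [A], [B], [C] would be pairwise equidistant on
    the line. *)
Lemma exceptional_unique (x y : V) :
  a != x -> b != x -> c != x -> a != y -> b != y -> c != y -> x != y ->
  exceptional x -> exceptional y -> False.
Proof.
move=> ax bx cx ay by_ cy xy [xa xb xc] [ya yb yc].
have D z : z \in [:: a; b; c] -> z != x -> z != y -> d z x = d z y ->
    d x y = d z x *+ 2.
  move=> zs zx zy E; have := degenerateP dM (deg zs zx zy xy).
  by have := metric_gt0 dM xy; rewrite -E => ? []; lra.
have Da := D a ina ax ay (etrans xa (esym ya)).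
have Db := D b inb bx by_ (etrans xb (esym yb)).
have Dc := D c inc cx cy (etrans xc (esym yc)).
have /eq_norm_cases E1 : `|B - C| = `|A - C| by rewrite -xa -xb; lra.
have /eq_norm_cases E2 : `|A - C| = `|A - B| by rewrite -xb -xc; lra.
by case: E1 => ?; case: E2 => ?; [apply: AB|apply: AB|apply: BC|apply: AC]; lra.
Qed.

(* [dist x y] is the distance from [Y] to at least two of the three points
   [A + B - C], [A + C - B], [B + C - A]; so [Y] is the midpoint of two of
   them, which is [A], [B] or [C]. *)
Lemma exceptional_not_placed (x y : V) (Y : R) :
  a != x -> b != x -> c != x -> a != y -> b != y -> c != y -> x != y ->
  exceptional x -> placed y Y -> False.
Proof.
move=> ax bx cx ay by_ cy xy [xa xb xc] [ya yb yc].
have YA : Y <> A.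
  by move=> E; have := metric_gt0 dM ay; rewrite ya E subrr normr0 ltxx.
have YB : Y <> B.
  by move=> E; have := metric_gt0 dM by_; rewrite yb E subrr normr0 ltxx.
have YC : Y <> C.
  by move=> E; have := metric_gt0 dM cy; rewrite yc E subrr normr0 ltxx.
(* [third_side] only looks at the sides at one vertex, so [x] may get a different coordinate at [c]
   than at [a] and [b]. *)
have xa' : d a x = `|(A + B - C) - A| by rewrite xa; congr `|_|; ring.
have xb' : d b x = `|(A + B - C) - B| by rewrite xb; congr `|_|; ring.
have xc' : d c x = `|(C + A - B) - C| by rewrite xc; congr `|_|; ring.
have Ha := third_side dM (deg ina ax ay xy) xa' ya.
have Hb := third_side dM (deg inb bx by_ xy) xb' yb.
have Hc := third_side dM (deg inc cx cy xy) xc' yc.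
have H12 : `|A + B - C - Y| <> `|C + A - B - Y|.
  by case/eq_norm_cases=> ?; [apply: BC | apply: YA]; lra.
have H13 : `|A + B - C - Y| <> `|B + C - A - Y|.
  by case/eq_norm_cases=> ?; [apply: AC | apply: YB]; lra.
have H23 : `|C + A - B - Y| <> `|B + C - A - Y|.
  by case/eq_norm_cases=> ?; [apply: AB | apply: YC]; lra.
have Fa : `|A + B - C + Y - 2 * A| = `|C + A - B - Y|.
  by rewrite -normrN; congr `|_|; ring.
have Fb : `|A + B - C + Y - 2 * B| = `|B + C - A - Y|.
  by rewrite -normrN; congr `|_|; ring.
have Fc : `|C + A - B + Y - 2 * C| = `|B + C - A - Y|.
  by rewrite -normrN; congr `|_|; ring.
(* Each vertex allows two of three pairwise distinct values for [d x y], and no value is allowed by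
   all three vertices. *)
rewrite Fa in Ha; rewrite Fb in Hb; rewrite Fc in Hc.
by case: Ha => ?; case: Hb => ?; case: Hc => ?; congruence.
Qed.

Lemma exists_placed (x : V) : (5 <= #|V|)%N -> exists X, placed x X.
Proof.
move=> V5; have sym := dist_sym dM; have refl := dist_refl dM.
have [<-|ax] := eqVneq a x.
  by exists A; split; rewrite ?refl ?subrr ?normr0 // sym.
have [<-|bx] := eqVneq b x.
  by exists B; split; rewrite ?refl ?subrr ?normr0 // 1?sym ?dbc // sym dab distrC.
have [<-|cx] := eqVneq c x.
  by exists C; split; rewrite ?refl ?subrr ?normr0 // ?dac ?dbc distrC.
have [//|ex] := placed_or_exceptional ax bx cx.
have /card_gt0P[y] : (0 < #|~: [set x; a; b; c]|)%N.
  rewrite cardsCs setCK subn_gt0; apply: leq_ltn_trans V5.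
  by rewrite -!setUA !cardsU1 cards1; do 3 case: (_ \notin _).
rewrite !inE !negb_or -!andbA ![y == _]eq_sym => /and4P[xy ay by_ cy].
case: (placed_or_exceptional ay by_ cy) => [[Y pY]|ey].
  by case: (exceptional_not_placed ax bx cx ay by_ cy xy ex pY).
by case: (exceptional_unique ax bx cx ay by_ cy xy ex ey).
Qed.

Lemma placed_dist (x y : V) (X Y : R) :
  placed x X -> placed y Y -> d x y = `|X - Y|.
Proof.
move=> [xa xb xc] [ya yb yc]; have sym := dist_sym dM.
have zero (z Z : R) : 0 = `|Z - z| -> Z = z.
  by move/esym/eqP; rewrite normr_eq0 subr_eq0 => /eqP.
(* The points [x] and [y] may coincide with each other or with [z]; there is then no triangle, but
   [d x y] is already [|X - Y|]. *)
have H z Z : z \in [:: a; b; c] -> d z x = `|X - Z| -> d z y = `|Y - Z| ->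
    d x y <> `|X - Y| -> d x y = `|X + Y - 2 * Z|.
  move=> zs zx zy nE.
  have [E|zNx] := eqVneq z x.
    by case: nE; move: zx zy; rewrite E (dist_refl dM) => /zero -> ->; exact: distrC.
  have [E|zNy] := eqVneq z y.
    by case: nE; move: zx zy; rewrite E (dist_refl dM) (sym y x) => -> /zero ->.
  have [E|xNy] := eqVneq x y; last first.
    by case: (third_side dM (deg zs zNx zNy xNy) zx zy).
  case: nE; subst y; rewrite (dist_refl dM).
  suff -> : X = Y by rewrite subrr normr0.
  (* Distances to the distinct reals [A] and [B] determine a coordinate. *)
  have := ya; have := yb; rewrite xa xb.
  by case/eq_norm_cases=> ?; case/eq_norm_cases=> ?; try lra; case: AB; lra.
have [//|/eqP nE] := eqVneq (d x y) `|X - Y|.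
have Ha := H a A ina xa ya nE.
have Hb := H b B inb xb yb nE.
have Hc := H c C inc xc yc nE.
by case: (no_three_equidistant (M := X + Y) AB BC AC); rewrite -?Ha -?Hb -?Hc.
Qed.

End Placement.

(** * From coordinates to the order, and the count *)

Lemma line_embedding (R : realType) (V : finType) (d : V -> V -> R) (S : {set V}) :
  (5 <= #|V|)%N -> #|S| = 3%N -> is_metric d ->
  (forall T : {set V}, #|T| = 3%N -> ~~ [disjoint T & S] -> degenerate d T) ->
  exists f : V -> R, forall x y, d x y = `|f x - f y|.
Proof.
move=> V5 S3 dM deg.
have /card_gt2P[a [b [c [[aS bS cS] [ab bc]]]]] : (2 < #|S|)%N by rewrite S3.
rewrite eq_sym => ac.
have degS z x y : z \in [:: a; b; c] -> z != x -> z != y -> x != y ->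
    degenerate d [set z; x; y].
  move=> zs zx zy xy; apply: deg.
    by rewrite -setUA !cardsU1 cards1 !inE negb_or zx zy xy.
  apply/pred0Pn; exists z; rewrite /= !inE eqxx /=.
  by move: zs; rewrite !inE => /or3P[] /eqP ->.
(* Put [a] at the origin and [b] at [d a b]; degeneracy of the triangle on [a], [b], [c] then yields
   [C]. *)
have dab : d a b = `|0 - d a b| by rewrite sub0r normrN ger0_norm ?metric_ge0.
have [C [dac dbc]] :=
  place_third dM (degS a b c (mem_head _ _) ab ac bc) dab.
rewrite distrC in dac; rewrite distrC in dbc.
have /fin_all_exists[f pf] x :=
  exists_placed dM ab bc ac dab dbc dac degS x V5.
by exists f => x y; apply: (placed_dist dM ab bc ac dab dbc dac degS).
Qed.

Lemma line_order (R : realType) (V : finType) (d : V -> V -> R) (f : V -> R) :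
  is_metric d -> (forall x y, d x y = `|f x - f y|) ->
  exists le : rel V, total_order le /\
    forall r s t : V,
      le r s && (r != s) -> le s t && (s != t) -> between d r s t.
Proof.
move=> dM df; exists (fun x y => f x <= f y).
have f_inj : injective f.
  by move=> x y E; apply: (dist_eq0 dM); rewrite df E subrr normr0.
split.
  split=> [|x y]; last exact: le_total.
  split=> [|x y /andP[xy yx]]; last by apply: f_inj; apply/eqP; rewrite eq_le xy.
  by split=> [x|y x z]; [exact: lexx | exact: le_trans].
move=> r s t /andP[rs rNs] /andP[st sNt].
have rt : f r < f t.
  by apply: lt_le_trans st; rewrite lt_neqAle (inj_eq f_inj) rNs.
split=> //; first by apply: contraTneq rt => ->; rewrite ltxx.
by rewrite !df !ler0_norm; lra.
Qed.

(** With [n = #|V|], the 3-sets missing [S] are those of its complement, so the count is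
    ['C(n, 3) - 'C(n - 3, 3)]. *)
Lemma card_triples_meeting (V : finType) (S : {set V}) :
  #|S| = 3%N ->
  #|[set T : {set V} | (#|T| == 3%N) && ~~ [disjoint T & S]]| =
    (3 * 'C(#|V| - 2, 2) + 1)%N.
Proof.
move=> S3.
have Vge3 : (3 <= #|V|)%N by rewrite -S3 max_card.
have := cardsID [set T : {set V} | [disjoint T & S]] [set T : {set V} | #|T| == 3%N].
rewrite card_draws => E.
have E1 : #|[set T : {set V} | #|T| == 3%N] :&: [set T : {set V} | [disjoint T & S]]| =
    'C(#|V| - 3, 3)%N.
  rewrite -S3 -(cardsC S) addKn S3 -cards_draws; congr #|pred_of_set _|.
  by apply/setP => T; rewrite !inE disjoints_subset andbC.
rewrite E1 in E.
have -> : [set T : {set V} | (#|T| == 3%N) && ~~ [disjoint T & S]] =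
    [set T : {set V} | #|T| == 3%N] :\: [set T : {set V} | [disjoint T & S]].
  by apply/setP => T; rewrite !inE andbC.
(* With [m = n - 3], Pascal's rule expands everything over [m], and ['C(m, 3)] cancels. *)
move: E; move: #|_ :\: _| => k; case: #|V| Vge3 => [|[|[|m]]] // _.
by rewrite !subSS !subn0 !binS !bin0 !bin1; lia.
Qed.

Theorem theorem3 (R : realType) (V : finType) (n : nat)
    (card_V : #|V| = n) (n_ge5 : (5 <= n)%N) :
  exists E : {set {set V}}, anchor R E /\ #|E| = (3 * 'C(n - 2, 2) + 1)%N.
Proof.
have [S S3] : exists S : {set V}, #|S| = 3%N.
  have /card_gt2P[a [b [c [_ [ab bc ca]]]]] : (2 < #|V|)%N by lia.
  exists [set a; b; c].
  by rewrite -setUA !cardsU1 cards1 !inE negb_or ab bc eq_sym ca.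
exists [set T : {set V} | (#|T| == 3%N) && ~~ [disjoint T & S]]; split; last first.
  by rewrite -card_V card_triples_meeting.
split=> [T|d dM deg]; first by rewrite inE => /andP[/eqP].
have [|T T3 TS|f df] := line_embedding _ S3 dM.
- by rewrite card_V.
- by apply: deg; rewrite inE T3 eqxx.
- exact: line_order dM df.
Qed.
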